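(* Let $q$ be a prime power, let $p$ be the characteristic of $\mathbb{F}_q$, and let $d\ge 2$ be an integer. Put $s=\gcd(q-1,d-1)$ and let $\varphi$ be Euler's totient function. Then $$ N_d(q)\le \begin{cases} q^{d-1}+(s-1)q^{d-1-\varphi(d-1)}, & \text{if } p\nmid d,\\ q^{d-1}+(s-1)q^{d-1-\varphi(d-1)}+(q-1)q^{d/p-1}, & \text{if } p\mid d.\end{cases} $$ In particular, $N_2(q)\le 2q-1$, and for any $d\ge 3$ one has $N_d(q)\le 3q^{d-1}$. Furthermore, $N_d(q)\le q^{d-1}$ if $p\nmid d$ and $\gcd(q-1,d-1)=1$.
   Context: For a function $f:\mathbb{F}_q\to\mathbb{F}_q$, the functional graph $\mathcal{G}_f$ is the directed graph on the vertex set $\mathbb{F}_q$ with an edge from $u$ to $v$ if and only if $f(u)=v$ (loops allowed). $N_d(q)$ denotes the number of pairwise non-isomorphic (as directed graphs) functional graphs $\mathcal{G}_f$ generated by all polynomials $f\in\mathbb{F}_q[X]$ of degree exactly $d$ (each polynomial being viewed as a map $\mathbb{F}_q\to\mathbb{F}_q$). *)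

(* Defs.v *)
From mathcomp Require Import all_boot all_order all_fingroup all_algebra all_field.

Set Implicit Arguments.
Unset Strict Implicit.
Unset Printing Implicit Defensive.

Import GRing.Theory.
Local Open Scope ring_scope.

(* A directed graph on the vertex set T, loops allowed, is the set of its
   edges, (u, v) being the edge from u to v. *)
Definition digraph (T : finType) : predArgType := {set T * T}.

Definition functional_graph (T : finType) (f : T -> T) : digraph T :=
  [set e : T * T | f e.1 == e.2].

Definition digraph_iso (T : finType) : rel (digraph T) :=
  fun G H =>
    [exists s : {perm T},
      [forall u, forall v, ((u, v) \in G) == ((s u, s v) \in H)]].

Lemma digraph_isoP (T : finType) (G H : digraph T) :
  reflect (exists2 s : T -> T, bijective s &
             forall u v, ((u, v) \in G) = ((s u, s v) \in H))
          (digraph_iso G H).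
Proof.
apply: (iffP existsP) => [[s Hs]|[s bij_s Hs]].
  exists s; first by exists (s^-1)%g; [exact: permK | exact: permKV].
  by move=> u v; move/forallP/(_ u)/forallP/(_ v)/eqP: Hs.
exists (perm (bij_inj bij_s)); apply/forallP => u; apply/forallP => v.
by rewrite !permE; rewrite -Hs.
Qed.

Lemma digraph_iso_equiv (T : finType) : equivalence_rel (@digraph_iso T).
Proof.
apply/equivalence_relP; split=> [G | G H].
  by apply/digraph_isoP; exists id => //; exists id.
move=> /digraph_isoP[s [t sK tK] Hs] K; apply/digraph_isoP/digraph_isoP.
  move=> [r bij_r Hr]; exists (r \o t) => [|u v /=].
    by apply: bij_comp => //; exists s.
  by rewrite -Hr Hs !tK.
move=> [r bij_r Hr]; exists (r \o s) => [|u v /=].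
  by apply: bij_comp => //; exists t.
by rewrite -Hr Hs.
Qed.

(* {poly_(d.+1) F} is the finite type of the polynomials of degree at most d,
   and size p = d.+1 says that the degree is exactly d. The polynomials are
   formal: d may exceed #|F| - 1, and distinct ones may induce the same map. *)
Definition poly_graphs (F : finFieldType) (d : nat) : {set digraph F} :=
  [set functional_graph (fun x => (val p).[x])
     | p : {poly_(d.+1) F} & size (val p) == d.+1].

Definition num_graphs (F : finFieldType) (d : nat) : nat :=
  #|equivalence_partition (@digraph_iso F) (poly_graphs F d)|.

Lemma poly_graphsP (F : finFieldType) (d : nat) (G : digraph F) :
  reflect (exists2 p : {poly F}, size p = d.+1 &
             G = functional_graph (fun x => p.[x]))
          (G \in poly_graphs F d).
Proof.
apply: (iffP imsetP) => [[p]|[p sz_p ->]].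
  by rewrite inE => /eqP sz_p ->; exists (val p).
have le_p : (size p <= d.+1)%N by rewrite sz_p.
by exists (npolyp d.+1 p); rewrite ?inE /= npolypK ?sz_p.
Qed.

(* Main.v *)
From HB Require Import structures.
Require Import Defs.
From mathcomp Require Import all_boot all_order all_fingroup all_algebra all_field.
From mathcomp Require Import ring.

(** Why the bound holds.  An affine bijection [g : x |-> a x + b] of [F] is
    itself a polynomial map, so conjugating a polynomial by it gives a
    polynomial [g^-1 \Po f \Po g] of the same degree, whose functional graph is
    isomorphic to that of [f].  Hence the number of graphs is at most the number
    of orbits of the affine group, of order [(q - 1) q], on the polynomials of
    degree [d] ([num_graphs_le_orbits]), and the Cauchy-Frobenius lemma turns
    that number into an average of fixed point counts.

    A polynomial is fixed by [g] exactly when it commutes with [g] under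
    composition.  Each fixed point count is bounded by exhibiting a set [J] of
    exponents below [d] such that a fixed polynomial is determined by its
    leading coefficient and its coefficients in [J]; there are then at most
    [(q - 1) q ^ #|J|] of them ([card_le_free_coefs]).

    - For the identity, [J] consists of all exponents, and the [(q - 1) q ^ d]
      polynomials contribute [q ^ (d - 1)] to the average.
    - For a translation [x |-> x + b] with [b != 0], fixed polynomials differ
      by, and also differ from ['X] by, polynomials invariant under the
      translation.  The degree of a nonzero invariant polynomial is divisible by
      the characteristic [p], as comparing the two highest coefficients shows
      ([translation_invariant_degree]).  So there are no fixed polynomials
      unless [p %| d], and the exponents divisible by [p] form a suitable [J]:
      the [q - 1] translations contribute at most [(q - 1) q ^ (d / p - 1)].
    - A map of slope [a != 1] has a fixed point, so it is conjugate to
      [x |-> a x], and [f] commutes with the latter exactly when [a ^ i = a] for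
      every exponent [i] of [f].  The exponent [d] forces [a ^ (d - 1) = 1],
      which leaves at most [s - 1] slopes, and excludes [0] and all [i] for
      which [i - 1] is prime to [d - 1], so [d - 1 - totient (d - 1)] exponents
      at most remain ([card_exponents_fixing_le]).  These maps, at most
      [(s - 1) q] in number, contribute at most
      [(s - 1) q ^ (d - 1 - totient (d - 1))].

    The sum of the three contributions is the bound in both cases, and the other
    claims are numerical consequences of it. *)

(** * The affine group and its action on polynomials by conjugation *)

Section AffineConjugation.

Set Implicit Arguments.
Unset Strict Implicit.
Unset Printing Implicit Defensive.

Import GRing.Theory.
Local Open Scope ring_scope.

Definition affine (F : finFieldType) : predArgType := {x : F * F | x.1 != 0}.

HB.instance Definition _ (F : finFieldType) := Finite.on (affine F).

Definition slope (F : finFieldType) (g : affine F) : F := (val g).1.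
Definition shift (F : finFieldType) (g : affine F) : F := (val g).2.

Lemma slope_neq0 (F : finFieldType) (g : affine F) : slope g != 0.
Proof. exact: valP g. Qed.

Lemma affine_eq (F : finFieldType) (g h : affine F) :
  slope g = slope h -> shift g = shift h -> g = h.
Proof.
rewrite /slope /shift => e1 e2; apply: val_inj.
by rewrite [LHS]surjective_pairing [RHS]surjective_pairing e1 e2.
Qed.

Definition mk_affine (F : finFieldType) (a b : F) (a0 : a != 0) : affine F :=
  exist (fun x : F * F => x.1 != 0) (a, b) a0.

Definition affine_one (F : finFieldType) : affine F :=
  mk_affine 0 (oner_neq0 F).
(** Composition of maps, the right factor acting first. *)
Definition affine_mul (F : finFieldType) (g h : affine F) : affine F :=
  mk_affine (slope g * shift h + shift g)
    (mulf_neq0 (slope_neq0 g) (slope_neq0 h)).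
Definition affine_inv (F : finFieldType) (g : affine F) : affine F :=
  mk_affine (- (slope g)^-1 * shift g) (invr_neq0 (slope_neq0 g)).

Lemma affine_mulA (F : finFieldType) : associative (@affine_mul F).
Proof.
by move=> g h k; apply: affine_eq; rewrite /slope /shift /=;
   rewrite ?mulrA // mulrDr mulrA addrA.
Qed.

Lemma affine_mul1g (F : finFieldType) :
  left_id (affine_one F) (@affine_mul F).
Proof.
by move=> g; apply: affine_eq; rewrite /slope /shift /= ?mul1r // addr0.
Qed.

Lemma affine_mulVg (F : finFieldType) :
  left_inverse (affine_one F) (@affine_inv F) (@affine_mul F).
Proof.
move=> g; apply: affine_eq; rewrite /slope /shift /=.
  exact: mulVf (slope_neq0 g).
exact: (etrans (congr1 (+%R _) (mulNr _ _)) (subrr _)).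
Qed.

HB.instance Definition _ (F : finFieldType) :=
  Finite_isGroup.Build (affine F) (@affine_mulA F) (@affine_mul1g F)
    (@affine_mulVg F).

Lemma card_affine (F : finFieldType) : #|affine F| = (#|F|.-1 * #|F|)%N.
Proof.
have -> : #|affine F| = #|setX [set~ (0 : F)] [set: F]|.
  by rewrite card_sig; apply: eq_card => x; rewrite !inE andbT.
by rewrite cardsX cardsC1 cardsT.
Qed.

Definition affine_poly (F : finFieldType) (g : affine F) : {poly F} :=
  slope g *: 'X + (shift g)%:P.

Lemma affine_poly1 (F : finFieldType) : affine_poly (1%g : affine F) = 'X.
Proof. by rewrite /affine_poly /slope /shift /= scale1r addr0. Qed.

Lemma affine_polyM (F : finFieldType) (g h : affine F) :
  affine_poly (g * h)%g = affine_poly g \Po affine_poly h.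
Proof.
rewrite /affine_poly comp_polyD comp_polyZ comp_polyX comp_polyC.
rewrite scalerDr scalerA -addrA; congr (_ + _).
have -> : slope g *: (shift h)%:P = (slope g * shift h)%:P.
  by rewrite polyCM mul_polyC.
by rewrite -polyCD.
Qed.

Lemma affine_polyK (F : finFieldType) (g : affine F) (f : {poly F}) :
  affine_poly g^-1%g \Po (affine_poly g \Po f) = f.
Proof. by rewrite comp_polyA -affine_polyM mulVg affine_poly1 comp_polyX. Qed.

Lemma affine_polyVK (F : finFieldType) (g : affine F) (f : {poly F}) :
  affine_poly g \Po (affine_poly g^-1%g \Po f) = f.
Proof. by rewrite comp_polyA -affine_polyM mulgV affine_poly1 comp_polyX. Qed.

Lemma size_affine_poly (F : finFieldType) (g : affine F) :
  size (affine_poly g) = 2%N.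
Proof.
rewrite /affine_poly size_polyDl size_scale ?size_polyX ?slope_neq0 //.
exact: leq_ltn_trans (size_polyC_leq1 _) _.
Qed.

(** Conjugating as [g^-1 o f o g] rather than [g o f o g^-1] gives a right
    action of the group of affine maps. *)
Definition conj_poly (F : finFieldType) (f : {poly F}) (g : affine F) :=
  affine_poly g^-1%g \Po (f \Po affine_poly g).

Lemma degree_conj_poly (F : finFieldType) (f : {poly F}) (g : affine F) :
  (size (conj_poly f g)).-1 = (size f).-1.
Proof.
by rewrite /conj_poly !size_comp_poly !size_affine_poly mul1n muln1.
Qed.

Lemma conj_poly_eqP (F : finFieldType) (f : {poly F}) (g : affine F) :
  (conj_poly f g = f) <-> (f \Po affine_poly g = affine_poly g \Po f).
Proof.
rewrite /conj_poly; split=> [{2}<- | ->]; first by rewrite affine_polyVK.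
by rewrite affine_polyK.
Qed.

Definition npoly_conj (F : finFieldType) (d : nat) (f : {poly_(d.+1) F})
  (g : affine F) : {poly_(d.+1) F} := npolyp d.+1 (conj_poly (val f) g).

Lemma val_npoly_conj (F : finFieldType) (d : nat) (f : {poly_(d.+1) F})
  (g : affine F) : val (npoly_conj f g) = conj_poly (val f) g.
Proof.
rewrite [val _]npolypK //.
have := size_npoly f; have := degree_conj_poly (val f) g; rewrite /=.
by case: (size (conj_poly _ _)) => //= k ->; case: (size _).
Qed.

Lemma npoly_conj1 (F : finFieldType) (d : nat) :
  (@npoly_conj F d)^~ 1%g =1 id.
Proof.
move=> f; apply: val_inj; rewrite val_npoly_conj /conj_poly.
by rewrite invg1 affine_poly1 comp_polyXr comp_polyX.
Qed.

Lemma npoly_conjM (F : finFieldType) (d : nat) (f : {poly_(d.+1) F}) :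
  act_morph (@npoly_conj F d) f.
Proof.
move=> g h; apply: val_inj; rewrite !val_npoly_conj /conj_poly.
by rewrite invMg !affine_polyM !comp_polyA.
Qed.

Definition conj_action (F : finFieldType) (d : nat) :=
  TotalAction (@npoly_conj1 F d) (@npoly_conjM F d).

Definition degree_eq (F : finFieldType) (d : nat) : {set {poly_(d.+1) F}} :=
  [set f : {poly_(d.+1) F} | size (val f) == d.+1].

Lemma acts_degree_eq (F : finFieldType) (d : nat) :
  (0 < d)%N -> [acts [set: affine F], on degree_eq F d | conj_action F d].
Proof.
move=> d_gt0; apply/actsP => g _ f; rewrite !inE.
have degE (h : {poly F}) : (size h == d.+1) = ((size h).-1 == d).
  by case: (size h) => [|n] //=; rewrite (ltn_eqF d_gt0).
by rewrite [val _]val_npoly_conj !degE degree_conj_poly.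
Qed.

Lemma conj_poly_horner (F : finFieldType) (f : {poly F}) (g : affine F) u :
  (affine_poly g).[(conj_poly f g).[u]] = f.[(affine_poly g).[u]].
Proof. by rewrite -horner_comp /conj_poly affine_polyVK horner_comp. Qed.

(** The affine map is itself the vertex bijection: [g o (g^-1 o f o g)]
    equals [f o g]. *)
Lemma digraph_iso_conj_poly (F : finFieldType) (f : {poly F}) (g : affine F) :
  digraph_iso (functional_graph (fun x => (conj_poly f g).[x]))
    (functional_graph (fun x => f.[x])).
Proof.
have gK : cancel (fun x => (affine_poly g).[x])
                 (fun x => (affine_poly g^-1%g).[x]).
  by move=> x; rewrite -horner_comp -affine_polyM mulVg affine_poly1 hornerX.
apply/digraph_isoP; exists (fun x => (affine_poly g).[x]).
  exists (fun x => (affine_poly g^-1%g).[x]) => // x.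
  by rewrite -horner_comp -affine_polyM mulgV affine_poly1 hornerX.
move=> u v; rewrite !inE /= -conj_poly_horner.
by rewrite (inj_eq (can_inj gK)).
Qed.

(** * From graphs to orbits *)

Lemma card_imset_factor (T U V : finType) (f : T -> U) (h : T -> V)
    (A : {set T}) :
  {in A &, forall x y, f x = f y -> h x = h y} ->
  (#|h @: A| <= #|f @: A|)%N.
Proof.
move=> fh; have [A0|[x0 _]] := set_0Vmem A; first by rewrite A0 !imset0 !cards0.
pose k u := h (odflt x0 [pick x in A | f x == u]).
suff /subset_leq_card le_hk : h @: A \subset k @: (f @: A).
  exact: leq_trans le_hk (leq_imset_card _ _).
apply/subsetP => _ /imsetP[x Ax ->]; apply/imsetP.
exists (f x); first exact: imset_f.
rewrite /k; case: pickP => [y /andP[Ay /eqP fy]|/(_ x)] /=; first by apply: fh.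
by rewrite Ax eqxx.
Qed.

Lemma num_graphs_le_orbits (F : finFieldType) (d : nat) :
  (num_graphs F d <=
     #|orbit (conj_action F d) [set: affine F] @: degree_eq F d|)%N.
Proof.
rewrite /num_graphs /equivalence_partition /poly_graphs -imset_comp.
apply: card_imset_factor => f h _ _ /orbit_eqP/orbitP[g _ <-] /=.
apply/setP => G; rewrite !inE; congr (_ && _).
have [_ iso_trans] := (equivalence_relP _).1 (@digraph_iso_equiv F).
by rewrite [val _]val_npoly_conj; apply/iso_trans/digraph_iso_conj_poly.
Qed.

(** * Fixed polynomials and their free coefficients *)

Lemma fix_conj_action_comm (F : finFieldType) (d : nat) (f : {poly_(d.+1) F})
    (g : affine F) :
  f \in 'Fix_(degree_eq F d | conj_action F d)[g]%g ->
  size (val f) = d.+1 /\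
  val f \Po affine_poly g = affine_poly g \Po val f.
Proof.
rewrite inE => /andP[]; rewrite inE => /eqP sz_f /afix1P fg; split=> //.
by apply/conj_poly_eqP; rewrite -val_npoly_conj; congr val.
Qed.

Lemma coef_degree_neq0 (R : nzSemiRingType) (f : {poly R}) (d : nat) :
  size f = d.+1 -> f`_d != 0.
Proof.
move=> sz_f; have := lead_coef_eq0 f.
by rewrite lead_coefE -size_poly_eq0 sz_f /= => ->.
Qed.

(** The leading coefficient takes only [#|F|.-1] values because it is nonzero;
    this factor cancels against the one in the order of the affine group. *)
Lemma card_le_free_coefs (F : finFieldType) (d : nat)
    (S : {set {poly_(d.+1) F}}) (J : {set 'I_d}) :
  (forall f, f \in S -> size (val f) = d.+1) ->
  (forall f h, f \in S -> h \in S -> (val f)`_d = (val h)`_d ->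
     (forall i : 'I_d, i \in J -> (val f)`_i = (val h)`_i) -> f = h) ->
  (#|S| <= #|F|.-1 * #|F| ^ #|J|)%N.
Proof.
move=> szS injS.
pose c (f : {poly_(d.+1) F}) : F * {ffun 'I_d -> F} :=
  ((val f)`_d, [ffun i : 'I_d => if i \in J then (val f)`_i else 0]).
have c_inj : {in S &, injective c}.
  move=> f h Sf Sh [eq_d /ffunP eqJ]; apply: injS => // i Ji.
  by have := eqJ i; rewrite !ffunE Ji.
have -> : (#|F|.-1 * #|F| ^ #|J|)%N =
    #|setX [set~ (0 : F)] [set h in pffun_on 0 (mem J) (mem F)]|.
  by rewrite cardsX cardsC1 cardsE card_pffun_on.
rewrite -(card_in_imset c_inj); apply/subset_leq_card/subsetP.
move=> _ /imsetP[f Sf ->]; rewrite !inE /=; apply/andP; split.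
  exact: coef_degree_neq0 (szS f Sf).
apply/pffun_onP; split=> //.
by apply/supportP => i /negPf Ji; rewrite ffunE Ji.
Qed.

Lemma card_sub_degree_eq_le (F : finFieldType) (d : nat)
    (S : {set {poly_(d.+1) F}}) :
  S \subset degree_eq F d -> (#|S| <= #|F|.-1 * #|F| ^ d)%N.
Proof.
move=> /subsetP sS.
have := @card_le_free_coefs F d S [set: 'I_d]; rewrite cardsT card_ord; apply.
  by move=> f /sS; rewrite inE => /eqP.
move=> f h _ _ eq_d eqJ; apply/npolyP => i.
have [lt_id|] := ltnP i d; first exact: (eqJ (Ordinal lt_id) (in_setT _)).
rewrite leq_eqVlt => /predU1P[<- //|lt_di].
by rewrite !big_coef_npoly.
Qed.

(** * Polynomials commuting with a translation *)

Lemma size_XaddC_exp (R : nzRingType) (b : R) (k : nat) :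
  size (('X + b%:P) ^+ k) = k.+1.
Proof. by rewrite -[b]opprK polyCN size_exp_XsubC. Qed.

Lemma lead_coef_XaddC_exp (R : nzRingType) (b : R) (k : nat) :
  (('X + b%:P) ^+ k)`_k = 1.
Proof.
have /monicP : ('X + b%:P) ^+ k \is monic by rewrite monic_exp ?monicXaddC.
by rewrite lead_coefE size_XaddC_exp.
Qed.

Lemma coef_XaddC_exp (R : comNzRingType) (b : R) (k : nat) :
  (('X + b%:P) ^+ k.+1)`_k = b *+ k.+1.
Proof.
elim: k => [|k IHk]; first by rewrite expr1 coefD coefX coefC add0r.
rewrite exprSr mulrDr coefD coefMX coefMC /= IHk [RHS]mulrSr; congr (_ + _).
by rewrite lead_coef_XaddC_exp mul1r.
Qed.

(** If [h] has leading term [c X^n], the coefficients of degree [n - 1] of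
    [h (X + b)] and of [h] differ by [n b c], so that [n] is zero in [F]. *)
Lemma translation_invariant_degree (F : finFieldType) (p : nat) (b : F)
    (h : {poly F}) :
  p \in [pchar F] -> b != 0 -> h \Po ('X + b%:P) = h ->
  (p %| (size h).-1)%N.
Proof.
move=> charFp b0 inv_h.
case sz_h: (size h).-1 => [|k]; first exact: dvdn0.
have sz : size h = k.+2 by case: (size h) sz_h => //= n ->.
have h0 : h`_k.+1 != 0 by apply: coef_degree_neq0.
have := congr1 (fun r : {poly F} => r`_k) inv_h.
rewrite coef_comp_poly sz big_ord_recr big_ord_recr /=.
rewrite lead_coef_XaddC_exp mulr1.
rewrite coef_XaddC_exp big1 ?add0r => [|i _]; last first.
  by rewrite [X in _ * X]nth_default ?mulr0 // size_XaddC_exp.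
move/(canRL (addKr _)); rewrite addNr => /eqP.
rewrite mulf_eq0 (negPf h0) /= -mulr_natr mulf_eq0 (negPf b0).
by rewrite -(dvdn_pcharf charFp).
Qed.

Lemma card_multiples_le (p d : nat) : (0 < p)%N -> (p %| d)%N ->
  (#|[set i : 'I_d | (p %| i)%N]| <= d %/ p)%N.
Proof.
move=> p_gt0 pd.
have lt_div (i : 'I_d) : (i %/ p < d %/ p)%N.
  by rewrite ltn_divRL // (leq_ltn_trans (leq_trunc_div i p)).
rewrite -[leqRHS]card_ord.
apply: (@leq_card_in _ _ (fun i => Ordinal (lt_div i))) => i j.
rewrite !inE => pi pj /(congr1 val)/= eq_ij; apply: val_inj.
by rewrite /= -(divnK pi) -(divnK pj) eq_ij.
Qed.

(** The difference of two fixed polynomials is invariant under the translation,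
    hence of degree divisible by [p] unless it is zero; so it is zero once its
    coefficients at the multiples of [p] vanish. *)
Lemma card_fix_translation_le (F : finFieldType) (p d : nat) (g : affine F) :
  p \in [pchar F] -> (1 < d)%N -> slope g = 1 -> g != 1%g ->
  (#|'Fix_(degree_eq F d | conj_action F d)[g]%g|
     <= if (p %| d)%N then #|F|.-1 * #|F| ^ (d %/ p) else 0)%N.
Proof.
move=> charFp d_gt1 slope_g g_neq1; set S := 'Fix_(_ | _)[_]%g.
have shift_g : shift g != 0.
  apply: contra_neq g_neq1 => b0; exact: affine_eq.
have affE : affine_poly g = 'X + (shift g)%:P.
  by rewrite /affine_poly slope_g scale1r.
have commS f : f \in S ->
    val f \Po affine_poly g = val f + (shift g)%:P.
  case/fix_conj_action_comm => _ ->.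
  by rewrite affE comp_polyD comp_polyX comp_polyC.
case: ifPn => [pd|npd]; last first.
  rewrite leqn0 cards_eq0; apply: contraR npd => /set0Pn[f Sf].
  have [sz_f _] := fix_conj_action_comm Sf.
  have := @translation_invariant_degree F p _ (val f - 'X) charFp shift_g.
  (* [val f - 'X] is invariant, of degree [d] as [d > 1]. *)
  rewrite size_polyDl ?sz_f ?size_polyN ?size_polyX //; apply.
  rewrite comp_polyB comp_polyX -affE commS // affE.
  by rewrite opprD addrACA subrr addr0.
have F_gt0 : (0 < #|F|)%N := ltnW (card_finNzRing_gt1 F).
have p_gt0 := prime_gt0 (pcharf_prime charFp).
apply: leq_trans
  (_ : #|F|.-1 * #|F| ^ #|[set i : 'I_d | (p %| i)%N]| <= _)%N; last first.
  by rewrite leq_mul // leq_pexp2l ?card_multiples_le.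
apply: card_le_free_coefs => [f /fix_conj_action_comm[]//|f h Sf Sh eq_d eqJ].
apply/eqP; rewrite -val_eqE -subr_eq0; apply/negPn/negP => dif0.
have := @translation_invariant_degree F p _ (val f - val h) charFp shift_g.
rewrite -affE comp_polyB !commS // opprD addrACA subrr addr0.
move=> /(_ erefl) p_deg.
have le_size : (size (val f - val h)%R <= d.+1)%N.
  rewrite (leq_trans (size_polyD _ _)) // geq_max size_polyN.
  by rewrite !size_npoly.
case sz: (size (val f - val h)%R) p_deg le_size => [|k] p_k.
  by rewrite -size_poly_eq0 sz in dif0.
rewrite ltnS leq_eqVlt => le_kd; have := coef_degree_neq0 sz.
rewrite coefB; case/predU1P: le_kd => [->|lt_kd].
  by rewrite eq_d subrr eqxx.
by rewrite (eqJ (Ordinal lt_kd)) ?inE // subrr eqxx.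
Qed.

(** * Polynomials commuting with an affine map of slope different from 1 *)

Lemma coef_comp_scaleX (R : comNzRingType) (a : R) (f : {poly R}) (i : nat) :
  (f \Po (a *: 'X))`_i = f`_i * a ^+ i.
Proof.
rewrite coef_comp_poly.
under eq_bigr => j _ do rewrite exprZn coefZ coefXn.
have [lt_if|le_fi] := ltnP i (size f).
  rewrite (bigD1 (Ordinal lt_if)) //= eqxx mulr1 big1 ?addr0 // => j.
  by rewrite -val_eqE eq_sym /= => /negPf->; rewrite !mulr0.
rewrite nth_default // mul0r big1 // => j _.
by rewrite gtn_eqF ?mulr0 // (leq_trans _ le_fi).
Qed.

Lemma expr_gcdn (R : nzSemiRingType) (a : R) (m n : nat) :
  a ^+ m = 1 -> a ^+ n = 1 -> a ^+ gcdn m n = 1.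
Proof.
case: m => [|m] am an; first by rewrite gcd0n.
have [u v uv _] := egcdnP n (ltn0Sn m).
have : a ^+ (u * m.+1) = 1 by rewrite mulnC exprM am expr1n.
by rewrite uv exprD mulnC exprM an expr1n mul1r.
Qed.

Lemma totient_le (n : nat) : (totient n <= n)%N.
Proof.
rewrite totient_count_coprime big_mkord -[leqRHS]card_ord -sum1_card.
by apply: leq_sum => i _; case: coprime.
Qed.

(** Put [m := d - 1], so that [a ^ m = 1].  The exponent [0] does not fix [a],
    and neither does [i + 1] when [i] is prime to [m], since otherwise
    [a ^ i = 1 = a ^ m] would give [a = 1].  The bound counts these
    [1 + totient m] exceptions among the [m + 1] exponents below [d]. *)
Lemma card_exponents_fixing_le (F : finFieldType) (d : nat) (a : F) :
  (0 < d)%N -> a ^+ d = a -> a != 0 -> a != 1 ->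
  (#|[set i : 'I_d | a ^+ i == a]| <= d - 1 - totient (d - 1))%N.
Proof.
move=> d_gt0 ad a0 a1; case: d d_gt0 ad => // m _ ad.
have {}ad : a ^+ m = 1.
  by apply: (mulIf a0); rewrite mul1r -exprSr.
have not_both i : ((a ^+ i.+1 == a) + coprime m i <= 1)%N.
  case: eqP => [ai|_]; last by case: coprime.
  rewrite leqNgt; apply/negP; case co: (coprime m i) => //= _.
  have {}ai : a ^+ i = 1 by apply: (mulIf a0); rewrite mul1r -exprSr.
  have := expr_gcdn ad ai; rewrite (eqP co) expr1 => a_1.
  by rewrite a_1 eqxx in a1.
rewrite subSS subn0 leq_subRL ?totient_le //.
rewrite -sum1_card big_mkcond totient_count_coprime big_mkord /=.
rewrite big_ord_recl inE expr0 eq_sym (negPf a1) add0n -big_split /=.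
rewrite -[leqRHS]card_ord -sum1_card; apply: leq_sum => i _.
by rewrite inE addnC; have := not_both i; case: (_ == _).
Qed.

Lemma card_fix_homothety_le (F : finFieldType) (d : nat) (g : affine F) :
  (1 < d)%N -> slope g != 1 -> shift g = 0 ->
  (#|'Fix_(degree_eq F d | conj_action F d)[g]%g|
     <= if slope g ^+ (d - 1) == 1%R
        then #|F|.-1 * #|F| ^ (d - 1 - totient (d - 1)) else 0)%N.
Proof.
move=> d_gt1; set a := slope g => a1 shift0; set S := 'Fix_(_ | _)[_]%g.
have a0 : a != 0 := slope_neq0 g.
have affE : affine_poly g = a *: 'X by rewrite /affine_poly shift0 addr0.
have coefS f i : f \in S -> (val f)`_i != 0 -> a ^+ i = a.
  case/fix_conj_action_comm => _; rewrite affE.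
  move/(congr1 (fun r : {poly F} => r`_i)).
  rewrite coef_comp_scaleX comp_polyZ comp_polyX coefZ mulrC => eq_i fi0.
  exact: (mulIf fi0).
have powd : (a ^+ (d - 1) == 1) = (a ^+ d == a).
  rewrite -{2}(subnK (ltnW d_gt1)) addn1 exprSr.
  apply/eqP/eqP => [->|eq_a]; first by rewrite mul1r.
  by apply: (mulIf a0); rewrite mul1r.
case: ifPn => [|nad]; last first.
  rewrite leqn0 cards_eq0; apply: contraR nad => /set0Pn[f Sf].
  have [sz_f _] := fix_conj_action_comm Sf.
  rewrite powd; apply/eqP/(coefS _ _ Sf).
  exact: coef_degree_neq0.
rewrite powd => /eqP ad.
have le_J := card_exponents_fixing_le (ltnW d_gt1) ad a0 a1.
set J := [set i : 'I_d | _] in le_J.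
have F_gt0 : (0 < #|F|)%N := ltnW (card_finNzRing_gt1 F).
apply: leq_trans (_ : #|F|.-1 * #|F| ^ #|J| <= _)%N; last first.
  by rewrite leq_mul // leq_pexp2l.
apply: card_le_free_coefs => [f /fix_conj_action_comm[]//|f h Sf Sh eq_d eqJ].
apply/npolyP => i.
have [lt_id|] := ltnP i d; last first.
  rewrite leq_eqVlt => /predU1P[<- //|lt_di].
  by rewrite !big_coef_npoly.
have [Ji|nJi] := boolP (Ordinal lt_id \in J); first exact: eqJ Ji.
have vanish k : k \in S -> (val k)`_i = 0.
  by move=> Sk; apply: contraNeq nJi => ki; rewrite inE (coefS k).
by rewrite [LHS]vanish // [RHS]vanish.
Qed.

(** The map [x |-> a x + b] has the fixed point [b / (1 - a)]; conjugating by
    the translation that moves [0] there reduces to a homothety. *)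
Lemma card_fix_affine_le (F : finFieldType) (d : nat) (g : affine F) :
  (1 < d)%N -> slope g != 1 ->
  (#|'Fix_(degree_eq F d | conj_action F d)[g]%g|
     <= if slope g ^+ (d - 1) == 1%R
        then #|F|.-1 * #|F| ^ (d - 1 - totient (d - 1)) else 0)%N.
Proof.
move=> d_gt1 a1.
pose t : affine F := mk_affine (shift g / (1 - slope g)) (oner_neq0 F).
pose h : affine F := mk_affine 0 (slope_neq0 g).
have gt : (g * t = t * h)%g.
  apply: affine_eq; rewrite /slope /shift /= -/(slope g) -/(shift g).
    by rewrite mulr1 mul1r.
  have : 1 - slope g != 0 by rewrite subr_eq0 eq_sym.
  move=> a1'; apply: (mulIf a1'); rewrite mulr0 add0r mulrDl mulrA !divfK //.
  by rewrite mulrBr mulr1 mulrC addrC subrK.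
have /(card_fix_homothety_le d_gt1) : slope h != 1 by [].
move=> /(_ erefl); apply: leq_trans.
rewrite -(card_imset _ (@act_inj _ _ _ (conj_action F d) t)).
apply/subset_leq_card/subsetP => _ /imsetP[f + ->].
rewrite inE => /andP[]; rewrite inE => Sf /afix1P fg; apply/setIP; split.
  have := actsP (acts_degree_eq F (ltnW d_gt1)) t (in_setT t) f.
  by rewrite !inE => ->.
by apply/afix1P; rewrite -actM -gt actM fg.
Qed.

(** Every nonzero [a] satisfies [a ^ (#|F| - 1) = 1], so the roots of unity of
    order dividing [m] are those of order dividing the gcd. *)
Lemma card_unity_roots_neq1_le (F : finFieldType) (m : nat) : (0 < m)%N ->
  (#|[set a : F | (a != 1%R) && (a ^+ m == 1%R)]| <= (gcdn (#|F| - 1) m) - 1)%N.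
Proof.
move=> m_gt0; set A := [set a : F | _]; set s := gcdn _ _.
have F_gt1 : (0 < #|F| - 1)%N by rewrite subn_gt0 card_finNzRing_gt1.
have s_gt0 : (0 < s)%N by rewrite gcdn_gt0 F_gt1.
have le_s : (#|1%R |: A| <= s)%N.
  rewrite cardE; apply: (@max_unity_roots F) (enum_uniq _) => //.
  apply/allP => a; rewrite mem_enum !inE unity_rootE => /predU1P[->|].
    by rewrite expr1n.
  case/andP => _ /eqP am; apply/eqP/expr_gcdn => //.
  have a0 : a != 0.
    apply: contra_eq_neq am => ->.
    by rewrite expr0n gtn_eqF // eq_sym oner_neq0.
  apply: (mulIf a0); rewrite mul1r -exprSr subn1 prednK ?expf_card //.
  exact: ltnW (card_finNzRing_gt1 F).
by move: le_s; rewrite cardsU1 inE eqxx /= leq_subRL // addnC.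
Qed.

(** * Counting the orbits *)

(** The Cauchy-Frobenius lemma, with the affine group cut into the identity, the
    other translations and the maps of slope different from [1].  The last
    summand is the contribution of the translations. *)
Lemma card_orbits_le (F : finFieldType) (p d : nat) :
  p \in [pchar F] -> (1 < d)%N ->
  (#|orbit (conj_action F d) [set: affine F] @: degree_eq F d| <=
     #|F| ^ (d - 1)
     + (gcdn (#|F| - 1) (d - 1) - 1) * #|F| ^ (d - 1 - totient (d - 1))
     + (if (p %| d)%N then (#|F| - 1) * #|F| ^ (d %/ p - 1) else 0))%N.
Proof.
move=> charFp d_gt1; set q := #|F|; set s := gcdn _ _; set e := (d - 1 - _)%N.
have q_gt1 : (1 < q)%N := card_finNzRing_gt1 F.
have q_gt0 := ltnW q_gt1.
have d_gt0 := ltnW d_gt1.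
have dp_gt0 : (p %| d)%N -> (0 < d %/ p)%N.
  move=> pd; rewrite divn_gt0 ?(prime_gt0 (pcharf_prime charFp)) //.
  exact: dvdn_leq.
set O := #|_ @: _|; set X := (q.-1 * q ^ d)%N; set Z := (q.-1 * q ^ e)%N.
set Y := (if (p %| d)%N then q.-1 * q ^ (d %/ p) else 0)%N.
pose trans : {set affine F} := [set g | (slope g == 1) && (g != 1%g)].
pose nontrans : {set affine F} :=
  [set g | (slope g != 1) && (slope g ^+ (d - 1) == 1)].
have card_trans : (#|trans| <= q.-1)%N.
  rewrite -(cardsC1 (0 : F)) -(card_in_imset (f := @shift F)); last first.
    move=> g h; rewrite !inE => /andP[/eqP g1 _] /andP[/eqP h1 _] eq_gh.
    by apply: affine_eq; rewrite // g1 h1.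
  apply/subset_leq_card/subsetP => _ /imsetP[g + ->]; rewrite !inE.
  case/andP => /eqP g1; apply: contraNneq => g0; exact/eqP/affine_eq.
have card_nontrans : (#|nontrans| <= (s - 1) * q)%N.
  apply: leq_trans (_ : #|setX [set a : F | (a != 1%R) && (a ^+ (d - 1) == 1%R)]
                             [set: F]| <= _)%N; last first.
    rewrite cardsX cardsT leq_mul2r.
    by rewrite card_unity_roots_neq1_le ?orbT // subn_gt0.
  rewrite -(card_imset _ val_inj); apply/subset_leq_card/subsetP.
  by move=> _ /imsetP[g + ->]; rewrite !inE andbT.
have fix_le (g : affine F) :
    (#|'Fix_(degree_eq F d | conj_action F d)[g]%g| <=
       (g \in [set 1%g]) * X + (g \in trans) * Y + (g \in nontrans) * Z)%N.
  rewrite !inE; have [->|g1] := eqVneq g 1%g.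
    rewrite mul1n; apply: leq_trans (_ : X <= _)%N; last first.
      by rewrite -addnA leq_addr.
    by apply: card_sub_degree_eq_le; rewrite subsetIl.
  have [a1|a1] := eqVneq (slope g) 1.
    by rewrite mul0n mul1n add0n addn0; apply: card_fix_translation_le.
  rewrite !mul0n !add0n.
  apply: leq_trans (card_fix_affine_le d_gt1 a1) _.
  by case: eqP; rewrite ?mul1n.
have sum_mem (A : {set affine F}) n : (\sum_g (g \in A) * n = #|A| * n)%N.
  by rewrite -big_distrl /= -sum1_card [in RHS]big_mkcond.
have le_tot : (O * (q.-1 * q) <= X + q.-1 * Y + (s - 1) * q * Z)%N.
  have := Frobenius_Cauchy (acts_degree_eq F d_gt0).
  rewrite cardsT card_affine => <-.
  apply: leq_trans (leq_sum _ (fun g _ => fix_le g)) _.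
  rewrite (eq_bigl xpredT) => [|g]; last by rewrite in_setT.
  rewrite !big_split /= !sum_mem cards1 mul1n.
  by rewrite !leq_add // leq_mul2r (card_trans, card_nontrans) orbT.
have G_gt0 : (0 < q.-1 * q)%N by rewrite muln_gt0 q_gt0 -subn1 subn_gt0 q_gt1.
rewrite -(leq_pmul2r G_gt0); apply: leq_trans le_tot _.
have powS k : (0 < k)%N -> (q ^ k = q ^ (k - 1) * q)%N.
  by move=> k_gt0; rewrite -expnSr subn1 prednK.
rewrite !mulnDl /X /Z (powS d) // addnAC !subn1; apply: leq_add.
  apply: leq_add; apply/eq_leq; ring.
rewrite /Y; case: ifP => [pd|_]; last by rewrite muln0.
rewrite (powS (d %/ p)%N) ?subn1; first by apply/eq_leq; ring.
exact: dp_gt0 pd.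
Qed.

End AffineConjugation.

Theorem theorem1 (F : finFieldType) (q p : nat)
    (hq : #|F| = q) (hp : p \in [pchar F]%R) :
  [/\ forall d : nat, 2 <= d ->
        let s := gcdn (q - 1) (d - 1) in
        num_graphs F d <=
          (if ~~ (p %| d)
           then q ^ (d - 1) + (s - 1) * q ^ (d - 1 - totient (d - 1))
           else q ^ (d - 1) + (s - 1) * q ^ (d - 1 - totient (d - 1))
                + (q - 1) * q ^ (d %/ p - 1)),
      num_graphs F 2 <= 2 * q - 1,
      forall d : nat, 3 <= d -> num_graphs F d <= 3 * q ^ (d - 1)
    & forall d : nat, 2 <= d -> ~~ (p %| d) -> gcdn (q - 1) (d - 1) = 1 ->
        num_graphs F d <= q ^ (d - 1)].
Proof.
have main d : 2 <= d ->
    num_graphs F d <= q ^ (d - 1)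
     + (gcdn (q - 1) (d - 1) - 1) * q ^ (d - 1 - totient (d - 1))
     + (if p %| d then (q - 1) * q ^ (d %/ p - 1) else 0).
  move=> d_gt1; rewrite -hq; apply: leq_trans (num_graphs_le_orbits F d) _.
  exact: card_orbits_le.
have q_gt1 : 1 < q by rewrite -hq card_finNzRing_gt1.
have q_gt0 := ltnW q_gt1.
have p_gt1 : 1 < p by rewrite prime_gt1 ?(GRing.pcharf_prime hp).
split=> [d d_gt1 /=||d d_gt2|d d_gt1 npd s1].
- by have := main d d_gt1; case: (p %| d); rewrite ?addn0.
- apply: leq_trans (main 2 isT) _.
  rewrite gcdn1 mul0n addn0 expn1 mul2n -addnn -addnBA // leq_add2l.
  case: ifPn => // p2; rewrite dvdn_prime2 ?(GRing.pcharf_prime hp) // in p2.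
  by rewrite (eqP p2) muln1.
- have d1_gt0 : 0 < d - 1 by rewrite subn_gt0 (ltn_trans _ d_gt2).
  apply: leq_trans (main d (ltnW d_gt2)) _.
  rewrite -[3]/(1 + 1 + 1) !mulnDl mul1n.
  apply: leq_add; first apply: leq_add => //.
    have tot_gt0 : 0 < totient (d - 1) by rewrite totient_gt0.
    apply: leq_trans (_ : q * q ^ (d - 1 - totient (d - 1)) <= _).
      rewrite leq_mul2r; apply/orP; right.
      apply: leq_trans (leq_subr _ _) _.
      apply: leq_trans (dvdn_leq _ (dvdn_gcdl _ _)) _; rewrite ?leq_subr //.
      by rewrite subn_gt0.
    by rewrite -expnS leq_pexp2l // ltn_subrL tot_gt0.
  case: ifP => // pd.
  apply: leq_trans (_ : q * q ^ (d %/ p - 1) <= _).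
    by rewrite leq_mul2r leq_subr orbT.
  have dp_gt0 : 0 < d %/ p.
    by rewrite (divn_gt0 _ (ltnW p_gt1)) (dvdn_leq _ pd) // (ltn_trans _ d_gt2).
  rewrite -expnS leq_pexp2l // subn1 prednK // leq_subRL ?add1n ?ltn_Pdiv //.
    exact: ltn_trans d_gt2.
  exact: ltn_trans d_gt2.
- by have := main d d_gt1; rewrite s1 (negPf npd) subnn mul0n !addn0.
Qed.
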